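(* Let $n\ge 2$ be an integer. The graph on $Z_n^*=Z_n\setminus\{0\}$ generated by $T(x)=x^2$ is connected if and only if $n=2$ or $n$ is a Fermat prime, that is, a prime of the form $n=2^{2^k}+1$ with $k\ge 0$ an integer.
   Context: $Z_n=\mathbb{Z}/n\mathbb{Z}$ and $Z_n^*=Z_n\setminus\{0\}$ denotes the set of nonzero residue classes modulo $n$ (not the group of units). The graph generated by a map $T:Z_n\to Z_n$ on a vertex set $V\subseteq Z_n$ is the finite simple undirected graph with vertex set $V$ in which two distinct points $x,y\in V$ are joined by an edge if and only if $T(x)=y$ or $T(y)=x$ (directions, self-loops and multiple connections are disregarded). *)

(* Defs.v *)
From mathcomp Require Import all_boot all_order all_algebra.

Set Implicit Arguments.
Unset Strict Implicit.
Unset Printing Implicit Defensive.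

(* Adjacency of two vertices in the graph generated by a map T on the vertex
   set V. T need not preserve V: an arrow x -> T x leaving V gives no edge.
   Vertices are elements of the subtype of V, so paths cannot leave V. *)
Definition gen_adj (A : finType) (T : A -> A) (V : {set A}) :
    rel {x : A | x \in V} :=
  fun x y => (x != y) && ((T (val x) == val y) || (T (val y) == val x)).
Arguments gen_adj {A} T V.

Definition graph_connected (X : finType) (e : rel X) : Prop :=
  forall x y : X, connect e x y.

(* 'Z_n is Z/nZ only for n >= 2 ('Z_0 and 'Z_1 both denote Z/2Z). *)
Definition Zn_star (n : nat) : {set 'Z_n} := [set x : 'Z_n | x != 0%R].

Definition fermat_prime (n : nat) : Prop :=
  prime n /\ exists k : nat, n = 2 ^ (2 ^ k) + 1.

(* Main.v *)
Require Import Defs.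
From mathcomp Require Import all_boot all_order all_algebra.
From mathcomp Require Import all_fingroup all_solvable.

Set Implicit Arguments.
Unset Strict Implicit.

(** The graph is analysed through one invariant of its edges: the property that
    [x ^+ (2 ^ k) = 1] for some [k] passes from [x] to [x ^+ 2] and back, hence
    is constant on components, and it holds at [1].  Conversely, an element with
    this property is joined to [1] by the path of its iterated squares, which
    never meets [0].  So the graph on the nonzero elements of any nontrivial
    finite ring is connected exactly when every nonzero element has the
    property ([square_graph_connected]).

    In [Z/n] such elements are units, so connectedness makes every nonzero
    residue a unit and [n] is prime.  The group of units has then order
    [n.-1], and by Cauchy's theorem all its elements have 2-power order exactly
    when this order is a power of 2 ([twopow_torsion_ZpP]).  Finally, a prime
    [2 ^ m + 1] with [0 < m] is a Fermat prime, since an odd prime factor of [m]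
    would give a proper algebraic factor ([prime_twopow_add1]); [m = 0] is the
    case [n = 2]. *)

Lemma gen_connect_invariant (A : finType) (T : A -> A) (V : {set A})
    (P : A -> Prop) (x y : {a : A | a \in V}) :
  (forall a, P (T a) <-> P a) ->
  connect (gen_adj T V) x y -> P (val x) -> P (val y).
Proof.
move=> PT /connectP[s + ->]; elim: s x => //= z s IHs x /andP[xz zs] Px.
apply: IHs zs _; case/andP: xz => _ /orP[]/eqP eT.
  by rewrite -eT; apply/PT.
by apply/PT; rewrite eT.
Qed.

Lemma gen_adj_sym (A : finType) (T : A -> A) (V : {set A}) :
  symmetric (gen_adj T V).
Proof. by move=> x y; rewrite /gen_adj eq_sym orbC. Qed.

Lemma gen_connect_iter (A : finType) (T : A -> A) (V : {set A}) k
    (x y : {a : A | a \in V}) :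
  (forall i, i <= k -> iter i T (val x) \in V) -> iter k T (val x) = val y ->
  connect (gen_adj T V) x y.
Proof.
elim: k x => [|k IHk] x Vx /= Tx; first by rewrite (val_inj Tx).
have VTx : T (val x) \in V by apply: (Vx 1).
pose z : {a : A | a \in V} := Sub (T (val x)) VTx.
have zy : connect (gen_adj T V) z y.
  apply: IHk => [i le_ik|]; rewrite SubK -iterSr //.
  exact: Vx.
(* A fixed point of [T] gives a step that is not an edge. *)
have [-> // | xz] := eqVneq x z.
by apply: connect_trans zy; apply: connect1; rewrite /gen_adj xz SubK eqxx.
Qed.

Definition twopow_torsion (R : pzRingType) (x : R) : Prop :=
  exists k, (x ^+ (2 ^ k) = 1)%R.

Lemma twopow_torsion_sqr (R : pzRingType) (x : R) :
  twopow_torsion (x ^+ 2)%R <-> twopow_torsion x.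
Proof.
split=> [[k xk]|[k xk]]; first by exists k.+1; rewrite expnS GRing.exprM.
by exists k; rewrite GRing.exprAC xk GRing.expr1n.
Qed.

Lemma iter_sqr (R : pzRingType) (x : R) k :
  iter k (fun y => y ^+ 2)%R x = (x ^+ (2 ^ k))%R.
Proof. by elim: k => //= k ->; rewrite -GRing.exprM -expnSr. Qed.

(** Forward, the component of [1] consists of [twopow_torsion] elements; backward,
    once a power of [x] is [1] no iterated square of [x] vanishes. *)
Lemma square_graph_connected (R : finNzRingType) :
  graph_connected (gen_adj (fun x : R => (x ^+ 2)%R) [set x : R | x != 0%R])
  <-> (forall x : R, x != 0%R -> twopow_torsion x).
Proof.
have V1 : 1%R \in [set x : R | x != 0%R] by rewrite inE GRing.oner_neq0.
pose one : {x : R | x \in [set x : R | x != 0%R]} := Sub 1%R V1.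
split=> [conn x x0 | tors].
  have Vx : x \in [set x : R | x != 0%R] by rewrite inE.
  apply: (gen_connect_invariant (@twopow_torsion_sqr R) (conn one (Sub x Vx))).
  by exists 0; rewrite GRing.expr1n.
have to1 x : connect (gen_adj (fun x : R => (x ^+ 2)%R)
                 [set x : R | x != 0%R]) x one.
  have /tors[k xk] : val x != 0%R by have := valP x; rewrite inE.
  apply: (@gen_connect_iter _ _ _ k) => [i le_ik|]; last by rewrite iter_sqr.
  rewrite inE iter_sqr; apply/eqP => xi0; have /eqP := xk.
  rewrite -(subnKC le_ik) expnD GRing.exprM xi0 GRing.expr0n.
  by rewrite expn_eq0 /= eq_sym GRing.oner_eq0.
move=> x y; apply: connect_trans (to1 x) _.
by rewrite sym_connect_sym //; exact: gen_adj_sym.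
Qed.

(** A proper divisor [d] of [n] is a nonzero residue that is not a unit. *)
Lemma prime_of_Zp_unit n : 1 < n ->
  (forall x : 'Z_n, x != 0%R -> x \is a GRing.unit) -> prime n.
Proof.
move=> n_gt1 allU; apply: contraT => /primePn[]; first by rewrite ltnNge n_gt1.
case=> d /andP[d_gt1 ltdn] dvdn.
have /allU : (d%:R : 'Z_n)%R != 0%R.
  by rewrite -val_eqE /= val_Zp_nat // modn_small // -lt0n ltnW.
by rewrite unitZpE // coprime_sym /coprime (gcdn_idPl dvdn) gtn_eqF.
Qed.

(** Forward, an odd prime factor of the order [n.-1] of the unit group would be
    the order of some unit, by Cauchy's theorem; backward, raising any unit to
    the order [2 ^ m] of that group gives [1]. *)
Lemma twopow_torsion_ZpP n : 1 < n ->
  (forall x : 'Z_n, x != 0%R -> twopow_torsion x)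
  <-> (prime n /\ exists m, n = 2 ^ m + 1).
Proof.
move=> n_gt1; split=> [tors | [pr_n [m def_n]] x x0].
  have pr_n : prime n.
    apply: prime_of_Zp_unit => // x /tors[k xk].
    by rewrite -(@GRing.unitrX_pos _ x (2 ^ k)) ?expn_gt0 // xk GRing.unitr1.
  split=> //; have cardU : #|units_Zp n| = n.-1.
    by rewrite card_units_Zp ?totient_prime ?prime_gt0.
  have /p_natP[m def_m] : 2.-nat n.-1.
    apply/pnatP => [|q pr_q]; first by rewrite -ltnS prednK // ltnW.
    rewrite -cardU => /(Cauchy pr_q)[u _ ou].
    have /tors[k uk] : val u != 0%R.
      by apply: contraTneq (valP u) => ->; rewrite GRing.unitr0.
    have : q %| 2 ^ k.
      by rewrite -ou order_dvdn; apply/eqP/val_inj; rewrite FinRing.val_unitX.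
    by rewrite Euclid_dvdX // dvdn_prime2 // => /andP[].
  by exists m; rewrite -def_m addn1 prednK // ltnW.
exists m.
have Ux : x \is a GRing.unit.
  rewrite -(natr_Zp x) unitZpE // prime_coprime // gtnNdvd ?lt0n //.
  by rewrite -[ltnRHS](Zp_cast n_gt1).
have card_U : #|units_Zp n| = 2 ^ m.
  by rewrite card_units_Zp ?totient_prime ?prime_gt0 // {1}def_n addn1.
have := @expg_cardG _ (units_Zp_group n) (FinRing.unit 'Z_n Ux) (in_setT _).
by rewrite card_U => /(congr1 val); rewrite FinRing.val_unitX.
Qed.

(** Modulo [x.+1] one has [x = -1], so an odd power of [x] is [-1] too. *)
Lemma dvdn_add1_expn_odd x q : odd q -> x.+1 %| (x ^ q).+1.
Proof.
move=> q_odd; have [->|x_gt0] := posnP x; first exact: dvd1n.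
rewrite -(odd_double_half q) q_odd expnS -mul2n expnM.
have : x.+1 %| ((x ^ 2) ^ q./2).-1.
  apply: dvdn_trans (dvdn_pred_predX _ _).
  by rewrite -subn1 -[1](exp1n 2) subn_sqr addn1 dvdn_mull.
set y := (x ^ 2) ^ q./2 => dvd_y.
have -> : (x * y).+1 = x * y.-1 + x.+1.
  by rewrite -[y in LHS]prednK ?expn_gt0 ?x_gt0 // mulnS addnC addnS.
by rewrite dvdn_addl // dvdn_mull.
Qed.

(** If [m = e * q] with [q] odd, then [2 ^ e + 1] divides [2 ^ m + 1]. *)
Lemma prime_twopow_add1 m : 0 < m -> prime (2 ^ m + 1) -> exists k, m = 2 ^ k.
Proof.
move=> m_gt0 pr; suff /p_natP[k ->] : 2.-nat m by exists k.
apply/pnatP => // q pr_q /dvdnP[e def_m].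
have [//|q_odd] := even_prime pr_q; first by move=> ->.
have e_gt0 : 0 < e by move: m_gt0; rewrite def_m muln_gt0 => /andP[].
(* [2 ^ e + 1] is a divisor strictly between [1] and [2 ^ m + 1]. *)
have /(primeP pr).2 : (2 ^ e).+1 %| 2 ^ m + 1.
  by rewrite addn1 def_m expnM; apply: dvdn_add1_expn_odd.
rewrite addn1 !eqSS expn_eq0 /= eqn_exp2l // def_m.
by rewrite -{1}[e]muln1 eqn_pmul2l // => /eqP q1; rewrite -q1 in pr_q.
Qed.

Theorem proposition4 (n : nat) (hn : 2 <= n) :
  graph_connected (gen_adj (fun x : 'Z_n => (x ^+ 2)%R) (Zn_star n))
  <-> (n = 2 \/ fermat_prime n).
Proof.
apply: iff_trans (square_graph_connected 'Z_n) _.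
apply: iff_trans (twopow_torsion_ZpP hn) _.
split=> [[pr_n [[|m] def_n]] | [-> | [pr_n [k def_n]]]].
- by left.
- right; split=> //; rewrite def_n in pr_n *.
  by have [k ->] := prime_twopow_add1 (ltn0Sn m) pr_n; exists k.
- by split=> //; exists 0.
- by split=> //; exists (2 ^ k).
Qed.
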